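(* Let $r \ge 2$ be an integer. There exists $n_0 = n_0(r)$ such that for every integer $n > n_0$ the following holds: if $\mathcal{A}, \mathcal{B} \subseteq [n]^{(r)}$ and the pair $(\mathcal{A}, \mathcal{B})$ is $1$-cross-avoiding, i.e. $|A \cap B| \ne 1$ for all $A \in \mathcal{A}$, $B \in \mathcal{B}$, then $$|\mathcal{A}||\mathcal{B}| \le \binom{\lfloor n/2 \rfloor}{r} \binom{\lceil n/2 \rceil}{r}.$$
   Context: $[n] = \{1, \ldots, n\}$ and $[n]^{(r)}$ is the collection of all $r$-element subsets of $[n]$. *)

(* Defs.v *)
From mathcomp Require Import all_boot.

Set Implicit Arguments.
Unset Strict Implicit.
Unset Printing Implicit Defensive.

(* [n]^(r), with 'I_n = {0, ..., n-1} in the role of the ground set [n]. *)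
Definition rsubsets (n r : nat) : {set {set 'I_n}} :=
  [set S : {set 'I_n} | #|S| == r].

Definition cross_avoiding (n l : nat) (A B : {set {set 'I_n}}) : Prop :=
  forall S T : {set 'I_n}, S \in A -> T \in B -> #|S :&: T| <> l.

(* Main.v *)
Require Import Defs.
From mathcomp Require Import all_boot.
From mathcomp Require Import zify.


(** Call a point shared if it lies on a member of [A] and on a member of [B].
    A shared point [x] has low degree in both families: if [x] lies on [S] in
    [A], then a member of [B] through [x] must meet [S] in a second point, so
    there are at most [c = r * 'C(n, r - 2)] of them, which is of order
    [n ^ (r - 2)] ([card_degree]).  Now let [a] points be covered by [A] only,
    [b] points by [B] only, and let [w] points be shared.  Counting separately
    the sets that avoid all shared points gives ([cross_avoiding_bound])
      [#|A| <= 'C(a, r) + c * w], [#|B| <= 'C(b, r) + c * w], [a + w + b <= n].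

    It remains to maximise the product of these bounds
    ([product_of_bounds_le]); say [a <= b].  If [a <= n / 32], then [A] is so
    sparse that the trivial bound ['C(n, r)] for [#|B|] suffices.  Otherwise
    ['C(a, r - 1)] is of order [n ^ (r - 1)], so handing all shared points
    over to [A] gains at least [w * 'C(a, r - 1) * 'C(b, r)] in the product,
    more than the error terms [c * w] contribute ([absorb_error]).  The
    product is then at most ['C(a + w, r) * 'C(b, r)], and this is largest for
    an equal division of the [n] points because [m |-> 'C(m, r)] is
    log-concave ([bin_balanced]). *)

(** * Products of binomial coefficients *)

(** The quotient ['C(m, r.+1) / 'C(m, r) = (m - r) / r.+1] increases with
    [m]. *)
Lemma bin_ratio_mono (r p q : nat) : p <= q ->
  'C(p, r.+1) * 'C(q, r) <= 'C(p, r) * 'C(q, r.+1).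
Proof.
move=> lepq; rewrite -(leq_pmul2l (ltn0Sn r)) mulnA mul_bin_left.
rewrite [leqRHS]mulnCA mul_bin_left -mulnA [leqRHS]mulnCA.
by rewrite leq_mul2r leq_sub2r ?orbT.
Qed.

(** Log-concavity of [m |-> 'C(m, r)]: moving two arguments towards each other
    increases the product.  By Pascal's rule, one unit step is
    [bin_ratio_mono]. *)
Lemma bin_shift (r p q d : nat) : p + d <= q ->
  'C(p, r) * 'C(q + d, r) <= 'C(p + d, r) * 'C(q, r).
Proof.
case: r => [|r]; first by rewrite !bin0.
elim: d p => [|d IHd] p; rewrite ?addn0 // addnS => lt_pd.
rewrite -addSn; apply: leq_trans (IHd p.+1 _); last by rewrite addSn.
rewrite addnS !binS mulnDr mulnDl leq_add2l.
by apply: bin_ratio_mono; lia.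
Qed.

Lemma bin_balanced (r p q n : nat) : p + q = n ->
  'C(p, r) * 'C(q, r) <= 'C(n./2, r) * 'C(uphalf n, r).
Proof.
move=> def_n; wlog le_pq : p q def_n / p <= q.
  move=> IH; case/orP: (leq_total p q) => [|le_qp]; first exact: IH.
  by rewrite mulnC; apply: IH => //; lia.
have [d [dp dq]] : exists d, n./2 = p + d /\ q = uphalf n + d.
  by exists (n./2 - p); split; lia.
by rewrite dq dp; apply: bin_shift; lia.
Qed.

Lemma bin_add_lower (a r w : nat) :
  'C(a, r.+1) + w * 'C(a, r) <= 'C(a + w, r.+1).
Proof.
elim: w => [|w IHw]; first by rewrite mul0n !addn0.
rewrite addnS binS mulSn addnCA addnC leq_add //.
by apply: leq_bin2l; lia.
Qed.

(** Expanding the left side, the terms with [c] are at most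
    [3 * c * w * 'C(b, r.+1)], whereas replacing [a] by [a + w] gains
    [w * 'C(a, r) * 'C(b, r.+1)]. *)
Lemma absorb_error (r a b w c : nat) : a <= b ->
  3 * c <= 'C(a, r) -> c * w <= 'C(b, r.+1) ->
  ('C(a, r.+1) + c * w) * ('C(b, r.+1) + c * w)
    <= 'C(a + w, r.+1) * 'C(b, r.+1).
Proof.
move=> le_ab le_c le_cw.
apply: leq_trans (leq_mul (bin_add_lower a r w) (leqnn _)).
have := leq_bin2l r.+1 le_ab.
move: le_c le_cw; set x := 'C(a, r.+1); set y := 'C(b, r.+1).
set z := 'C(a, r) => le_c le_cw le_xy.
rewrite !mulnDl !mulnDr -addnA leq_add2l.
have h1 : x * (c * w) <= y * (c * w) by rewrite leq_mul2r le_xy orbT.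
have h2 : c * w * (c * w) <= y * (c * w) by rewrite leq_mul2r le_cw orbT.
have h3 : w * y * (3 * c) <= w * y * z by rewrite leq_mul2l le_c orbT.
by lia.
Qed.

(** * The numerical optimisation *)

Lemma leq_ffact_exp (n k : nat) : n ^_ k <= n ^ k.
Proof.
elim: k => [|k IHk]; first by rewrite ffactn0.
by rewrite ffactnSr expnSr leq_mul ?leq_subr.
Qed.

Lemma leq_exp_ffact (m k : nat) : (m - k) ^ k <= m ^_ k.
Proof.
elim: k => [|k IHk]; first by rewrite ffactn0.
rewrite ffactnSr expnSr leq_mul //; last by lia.
by apply: leq_trans IHk; case: k => // k; rewrite leq_exp2r //; lia.
Qed.

(** If [m] is a fixed proportion of [n], then ['C(m, k)] has order [n ^ k]; the
    denominators are cleared to stay in the natural numbers. *)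
Lemma leq_exp_bin (n s m k : nat) : n <= s * (m - k) ->
  n ^ k <= s ^ k * ('C(m, k) * k`!).
Proof.
move=> le_n; rewrite bin_ffact.
apply: leq_trans (leq_mul (leqnn _) (leq_exp_ffact m k)).
by rewrite -expnMn; case: k le_n => // k le_n; rewrite leq_exp2r.
Qed.

Lemma leq_bin_exp (n k : nat) : 'C(n, k) <= n ^ k.
Proof.
apply: leq_trans (leq_ffact_exp n k).
by rewrite -bin_ffact leq_pmulr // fact_gt0.
Qed.

(** Chosen to dominate the constants in the three places where a power
    [n ^ k.+1] has to beat a constant multiple of [n ^ k]. *)
Definition threshold (r : nat) := 3 * r * r`! * 64 ^ r.

(** The minimum with ['C(n, r)] matters only when [a] is small: the bound
    ['C(b, r) + c * w] alone is awkward there. *)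
Lemma product_of_bounds_le (k n a b w : nat) (r := k.+2) (c := r * 'C(n, k)) :
  threshold r < n -> a + w + b <= n -> a <= b ->
  minn ('C(n, r)) ('C(a, r) + c * w) * minn ('C(n, r)) ('C(b, r) + c * w)
    <= 'C(n./2, r) * 'C(uphalf n, r).
Proof.
move=> lt_n le_abw le_ab.
have f_gt0 := fact_gt0 r; have p_gt0 : 0 < 64 ^ r by rewrite expn_gt0.
have le_64r : 64 * r <= n.
  have h : 64 <= 64 ^ r by rewrite -{1}(expn1 64) leq_exp2l.
  have h2 : r * 64 <= r * 64 ^ r by rewrite leq_mul2l h orbT.
  have h3 : 1 * (r * 64 ^ r) <= (3 * r`!) * (r * 64 ^ r).
    by rewrite leq_mul2r; apply/orP; right; lia.
  by move: lt_n; rewrite /threshold; lia.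
have le_c : c <= r * n ^ k by rewrite leq_mul2l leq_bin_exp orbT.
have le_cw : c * w <= r * n ^ k.+1.
  by rewrite expnSr mulnA leq_mul //; lia.
(* After multiplication by [r`! ^ 2], the target is at least
   [(n / 4) ^ (2 * r)].  In the sparse case it suffices that [a ^ r] and
   [r`! * (c * w)] are each at most half of [n ^ r / 16 ^ r]; the factor 2 in
   [32 = 2 * 16] provides the half for [a ^ r]. *)
have [le_an|lt_na] := leqP (32 * a) n.
  have lower : n ^ r <= 4 ^ r * ('C(n./2, r) * r`!) by apply: leq_exp_bin; lia.
  have upper : 'C(n, r) * r`! <= n ^ r by rewrite bin_ffact leq_ffact_exp.
  have le_half : 'C(n./2, r) <= 'C(uphalf n, r) by apply: leq_bin2l; lia.
  apply: leq_trans (leq_mul (leqnn _) le_half).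
  apply: (@leq_trans (('C(a, r) + c * w) * 'C(n, r))).
    by rewrite leq_mul ?geq_minr ?geq_minl.
  have small : 16 ^ r * (('C(a, r) + c * w) * r`!) <= n ^ r.
    have ea : 2 * 16 ^ r * ('C(a, r) * r`!) <= n ^ r.
      apply: leq_trans (_ : (32 * a) ^ r <= _); last by rewrite leq_exp2r.
      rewrite (_ : 32 = 2 * 16) // -mulnA !expnMn -mulnA leq_mul //.
        by rewrite -{1}(expn1 2) leq_exp2l.
      by rewrite leq_mul // bin_ffact leq_ffact_exp.
    have ew : 2 * 16 ^ r * (c * w * r`!) <= n ^ r.
      apply: (@leq_trans (2 * 16 ^ r * (r * n ^ k.+1 * r`!))).
        by rewrite leq_mul // leq_mul.
      rewrite (_ : _ * _ = 2 * r * r`! * 16 ^ r * n ^ k.+1); last by lia.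
      rewrite [n ^ r]expnS leq_mul //.
      apply: leq_trans (ltnW lt_n); rewrite /threshold.
      by rewrite leq_mul ?leq_exp2r // leq_mul // leq_mul.
    by lia.
  have Q_gt0 : 0 < 16 ^ r * (r`! * r`!) by rewrite muln_gt0 expn_gt0 muln_gt0 f_gt0.
  rewrite -(leq_pmul2l Q_gt0).
  apply: (@leq_trans (n ^ r * n ^ r)).
    have := leq_mul small upper; lia.
  have := leq_mul lower lower.
  rewrite (_ : 16 = 4 * 4) // expnMn; lia.
(* Here [n <= 64 * (a - r)], so binomials of [a] and [b] have full order. *)
have rescale (m e : nat) : a <= m -> e <= r -> n ^ e <= 64 ^ e * ('C(m, e) * e`!).
  by move=> *; apply: leq_exp_bin; lia.
apply: (@leq_trans ('C(a + w, r) * 'C(b, r))); last first.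
  apply: leq_trans (_ : 'C(a + w, r) * 'C(n - (a + w), r) <= _).
    by rewrite leq_mul // leq_bin2l //; lia.
  by apply: bin_balanced; lia.
apply: leq_trans (leq_mul (geq_minr _ _) (geq_minr _ _)) _.
apply: absorb_error => //.
  have Q_gt0 : 0 < 64 ^ k.+1 * k.+1`! by rewrite muln_gt0 expn_gt0 fact_gt0.
  rewrite -(leq_pmul2l Q_gt0).
  apply: leq_trans (_ : n ^ k.+1 <= _); last first.
    by apply: leq_trans (rescale a k.+1 _ _) _ => //; lia.
  apply: (@leq_trans (64 ^ k.+1 * k.+1`! * (3 * (r * n ^ k)))).
    by rewrite leq_mul // leq_mul.
  rewrite (_ : _ * _ = 3 * r * k.+1`! * 64 ^ k.+1 * n ^ k); last by lia.
  rewrite [n ^ k.+1]expnS leq_mul //.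
  apply: leq_trans (ltnW lt_n); rewrite /threshold.
  by rewrite leq_mul ?leq_exp2l // leq_mul // [r`!]factS leq_pmull.
have Q_gt0 : 0 < 64 ^ r * r`! by rewrite muln_gt0 p_gt0.
rewrite -(leq_pmul2l Q_gt0).
apply: leq_trans (_ : n ^ r <= _); last first.
  by rewrite -mulnA [r`! * _]mulnC; apply: rescale.
apply: (@leq_trans (64 ^ r * r`! * (r * n ^ k.+1))); first by rewrite leq_mul.
rewrite mulnA [n ^ r]expnS leq_mul //.
by move: lt_n; rewrite /threshold; lia.
Qed.

(** * Degrees in cross-avoiding families *)

Section Families.
Context {n : nat}.
Implicit Types (A B : {set {set 'I_n}}) (x y : 'I_n).

Lemma leq_card_bigcup (I T : finType) (D : {set I}) (F : I -> {set T}) m :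
  (forall i, i \in D -> #|F i| <= m) -> #|\bigcup_(i in D) F i| <= m * #|D|.
Proof.
move=> leF; rewrite mulnC -sum_nat_const.
elim/big_ind2: _ => [|s1 X s2 Y le1 le2|i /leF//]; first by rewrite cards0.
by apply: leq_trans (leq_card_setU _ _) _; apply: leq_add.
Qed.

(** Deleting [x] and [y] is injective on these sets. *)
Lemma card_codegree k x y : x != y ->
  #|[set T in rsubsets n k.+2 | (x \in T) && (y \in T)]| <= 'C(n, k).
Proof.
move=> neq_xy; pose f (T : {set 'I_n}) := T :\: [set x; y].
set D := [set T in _ | _].
have sub2 (T : {set 'I_n}) : T \in D -> [set x; y] \subset T.
  by rewrite !inE subUset !sub1set => /andP[].
rewrite -(@card_in_imset _ _ f); last first.
  move=> T1 T2 /sub2 s1 /sub2 s2 eq_f.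
  by rewrite -(setID T1 [set x; y]) -(setID T2 [set x; y]) (setIidPr s1)
             (setIidPr s2) -/(f T1) eq_f.
apply: (@leq_trans #|[set T : {set 'I_n} | #|T| == k]|); last first.
  by rewrite card_draws card_ord.
apply/subset_leq_card/subsetP => _ /imsetP[T TD ->].
have sT := sub2 _ TD; rewrite inE /f cardsD (setIidPr sT) cards2 neq_xy.
by move: TD; rewrite !inE => /andP[/eqP-> _]; rewrite subn2.
Qed.

(** A member of [B] through [x] meets [S] in [x], hence also in one of the other
    points [y] of [S]; the sets through [x] and [y] are few by
    [card_codegree]. *)
Lemma card_degree k A B x (S : {set 'I_n}) :
  A \subset rsubsets n k.+2 -> B \subset rsubsets n k.+2 ->
  cross_avoiding 1 A B -> S \in A -> x \in S ->
  #|[set T in B | x \in T]| <= k.+2 * 'C(n, k).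
Proof.
move=> sA sB avoid SA xS.
have cS : #|S| = k.+2 by have := subsetP sA _ SA; rewrite inE => /eqP.
pose F y := [set T in rsubsets n k.+2 | (x \in T) && (y \in T)].
apply: (@leq_trans #|\bigcup_(y in S :\ x) F y|).
  apply/subset_leq_card/subsetP => T; rewrite inE => /andP[TB xT].
  have [y] : exists y, y \in (S :&: T) :\ x.
    apply/set0Pn; apply/negP => /eqP e; apply: (avoid _ _ SA TB).
    by rewrite (cardsD1 x) e cards0 inE xS xT.
  rewrite !inE => /andP[yx /andP[yS yT]]; apply/bigcupP; exists y.
    by rewrite !inE yx.
  by rewrite inE (subsetP sB _ TB) xT.
apply: leq_trans (leq_card_bigcup _ _ (S :\ x) F ('C(n, k)) _) _.
  by move=> y; rewrite !inE eq_sym => /andP[neq_xy _]; apply: card_codegree.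
by rewrite mulnC leq_mul // -cS subset_leq_card // subD1set.
Qed.

(** A member of [A] that leaves [U] is counted at a point of [W]. *)
Lemma card_split k A (U W : {set 'I_n}) c :
  A \subset rsubsets n k -> (forall S, S \in A -> S \subset U :|: W) ->
  (forall x, x \in W -> #|[set S in A | x \in S]| <= c) ->
  #|A| <= 'C(#|U|, k) + c * #|W|.
Proof.
move=> sA cover deg; rewrite -cards_draws.
apply: leq_trans (leq_add (leqnn _) (leq_card_bigcup _ _ W _ c deg)).
apply: leq_trans (leq_card_setU _ _).
apply/subset_leq_card/subsetP => S SA; rewrite !inE.
have := subsetP sA _ SA; rewrite inE => ->; rewrite andbT.
have [//|/subsetPn[x xS xU]] := boolP (S \subset U).
apply/bigcupP; exists x; last by rewrite inE SA.
by have := subsetP (cover _ SA) _ xS; rewrite inE (negbTE xU).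
Qed.

Lemma cross_avoiding_sym l A B : cross_avoiding l A B -> cross_avoiding l B A.
Proof. by move=> h S T SB TA; rewrite setIC; apply: h. Qed.

Lemma card_rsubsets k A : A \subset rsubsets n k -> #|A| <= 'C(n, k).
Proof. by move/subset_leq_card; rewrite card_draws card_ord. Qed.

(** The points covered by exactly one of the families are disjoint for [A] and
    [B], while all points covered by both have small degree. *)
Lemma cross_avoiding_bound k A B :
  A \subset rsubsets n k.+2 -> B \subset rsubsets n k.+2 ->
  cross_avoiding 1 A B ->
  let c := k.+2 * 'C(n, k) in
  exists a b w, [/\ a + w + b <= n,
    #|A| <= 'C(a, k.+2) + c * w & #|B| <= 'C(b, k.+2) + c * w].
Proof.
move=> sA sB avoid c; pose UA := cover A; pose UB := cover B.
exists #|UA :\: UB|, #|UB :\: UA|, #|UA :&: UB|; split.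
- rewrite [X in X + _]addnC cardsID.
  have -> : #|UA| + #|UB :\: UA| = #|UA :|: UB|.
    by rewrite cardsU cardsD setIC; have := subset_leq_card (subsetIr UA UB); lia.
  by rewrite -[leqRHS]card_ord max_card.
- apply: card_split => // [S SA|x].
    by rewrite setUC setID; apply: bigcup_sup.
  rewrite inE => /andP[_ /bigcupP[T TB xT]].
  exact: card_degree (cross_avoiding_sym _ _ _ avoid) TB xT.
- apply: card_split => // [S SB|x].
    by rewrite [UA :&: _]setIC setUC setID; apply: bigcup_sup.
  rewrite inE => /andP[/bigcupP[T TA xT] _].
  exact: card_degree avoid TA xT.
Qed.

End Families.

Theorem theorem1p6 (r : nat) (hr : 2 <= r) :
  exists n0 : nat, forall n : nat, n0 < n ->
  forall A B : {set {set 'I_n}},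
    A \subset rsubsets n r -> B \subset rsubsets n r ->
    cross_avoiding 1 A B ->
    #|A| * #|B| <= 'C(n./2, r) * 'C(uphalf n, r).
Proof.
exists (threshold r) => n.
case: r hr => [|[|k]] // _ lt_n A B sA sB avoid.
have [a [b [w [le_n leA leB]]]] := cross_avoiding_bound k A B sA sB avoid.
have leA' := card_rsubsets _ _ sA; have leB' := card_rsubsets _ _ sB.
case/orP: (leq_total a b) => le_ab; last rewrite mulnC.
  by apply: leq_trans (product_of_bounds_le k n a b w lt_n le_n le_ab);
    rewrite leq_mul // leq_min ?leA ?leB ?leA' ?leB'.
apply: leq_trans (product_of_bounds_le k n b a w lt_n _ le_ab); last by lia.
by rewrite leq_mul // leq_min ?leA ?leB ?leA' ?leB'.
Qed.
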